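(* Let $p$ be a prime and let $r,s,t$ be positive integers such that $m:=s-r+1$ and $n:=t-s-2r+2$ satisfy $4\le n\le m\le\frac12 n(n-1)$. Then there exists a $p$-group $G$ of nilpotency class $2$ with the following properties: (i) $|G|=p^t$ and $|Z(G)|=|G'|=p^s$; (ii) $\exp(G)=p^r$ if $p\neq2$, and $\exp(G)=2^{r+1}$ if $p=2$; (iii) $K(G)\neq G'$.
   Context: $Z(G)$ is the center of $G$, $\exp(G)$ is the exponent of $G$, $K(G)=\{xyx^{-1}y^{-1}:x,y\in G\}$ is the set of commutators, and $G'$ is the derived subgroup, generated by $K(G)$. *)

(* Defs.v *)
From mathcomp Require Import all_boot all_order all_algebra all_fingroup all_solvable.

Set Implicit Arguments.
Unset Strict Implicit.
Unset Printing Implicit Defensive.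

Local Open Scope group_scope.

(* The commutators x y x^-1 y^-1 of elements of G. MathComp's [~ x, y] is
   x^-1 y^-1 x y, i.e. the opposite convention; for a group G both give the
   same set, see commutatorsE. *)
Definition commutators (gT : finGroupType) (G : {set gT}) : {set gT} :=
  [set x * y * x^-1 * y^-1 | x in G, y in G].

Lemma commutatorsE (gT : finGroupType) (G : {group gT}) :
  commutators G = commg_set G G.
Proof.
apply/setP=> z; apply/imset2P/imset2P=> -[x y Gx Gy ->];
  exists x^-1 y^-1; rewrite ?groupV // ?commgEl ?conjgE ?invgK ?mulgA //.
Qed.

(* Main.v *)
Require Import Defs.
From HB Require Import structures.
From mathcomp Require Import all_boot all_order all_algebra all_fingroup all_solvable.
From mathcomp Require Import ring zify.

(** The group is a central extension of an abelian group A by an abelian group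
C, with underlying set A * C and product
(a, c)(b, d) = (a + b, c + d + beta a b) for a biadditive beta : A -> A -> C.
Its commutators are the (0, beta a b - beta b a), so the centre, the derived
subgroup and the set of commutators can all be read off the alternating map
[a, b] = beta a b - beta b a: the centre is C when this map is nondegenerate,
the derived subgroup is C when its values generate C, and some element of the
derived subgroup is not a commutator when its values do not exhaust C.

The alternating map comes from a graph with n vertices and m edges. Take
A = (Z/p^r)^2 x (Z/p)^(n-2), with one cyclic factor per vertex, and
C = Z/p^r x (Z/p)^(m-1), with one cyclic factor per edge; the factor of order
p^r belongs to the edge joining the two vertices 0 and 1 of order p^r. The
component of [a, b] at the edge uv is the minor a_u b_v - b_u a_v, reduced
modulo p for all edges but 01. If no vertex is isolated the map is
nondegenerate, and [e_u, y e_v] lies in the factor of uv, so the values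
generate C.

Modulo p the components of [a, b] are Pluecker coordinates of the bivector
a /\ b, and therefore satisfy p01 p23 - p02 p13 + p03 p12 = 0. If the graph
contains the edges 01, 02, 03 and 12, the relation forbids p01 = p02 = 0
together with p03 = p12 = 1, whatever the other three coordinates are: this is
graph_form_not_value. Joining 0 to all other vertices
and adding the edge 12 takes n edges and leaves no vertex isolated, and any
further edges may be added: this is the range n <= m <= n (n - 1) / 2, while
n >= 4 makes room for the four vertices.

For the exponent, (a, c)^k = (k a, k c + binom(k, 2) beta a a). The term
binom(p^r, 2) beta a a vanishes for odd p. For p = 2 it does not when
beta a a is a generator of Z/2^r, as binom(2^r, 2) is an odd multiple of
2^(r-1); this doubles the exponent. *)

Set Implicit Arguments.
Unset Strict Implicit.
Unset Printing Implicit Defensive.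

Import GRing.Theory.

(** * Central extensions defined by biadditive maps *)

(* Products and function spaces over finite abelian groups become finZmodType's. *)
HB.saturate prod.
HB.saturate finfun_of.

Record biadditive (A C : zmodType) := Biadditive {
  form :> A -> A -> C;
  formDl : forall a a' b, form (a + a')%R b = (form a b + form a' b)%R;
  formDr : forall a b b', form a (b + b')%R = (form a b + form a b')%R }.

(** A copy of A * C that mentions beta, so that the group structures of
different maps beta on the same product do not clash. *)
Definition central_ext (A C : finZmodType) (beta : biadditive A C) : Type :=
  (A * C)%type.

Section CentralExtension.

Local Open Scope ring_scope.

Variables (A C : finZmodType) (beta : biadditive A C).
Local Notation X := (central_ext beta).

Lemma form0l a : beta 0 a = 0.
Proof. by apply: (addrI (beta 0 a)); rewrite -formDl !addr0. Qed.

Lemma form0r a : beta a 0 = 0.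
Proof. by apply: (addrI (beta a 0)); rewrite -formDr !addr0. Qed.

Lemma formNl a b : beta (- a) b = - beta a b.
Proof. by apply: (addrI (beta a b)); rewrite -formDl !subrr form0l. Qed.

Lemma formMnl a b k : beta (a *+ k) b = beta a b *+ k.
Proof. by elim: k => [|k IHk]; rewrite ?form0l // !mulrS formDl IHk. Qed.

HB.instance Definition _ := Finite.copy X (A * C)%type.

Definition ext_mul (x y : X) : X := (x.1 + y.1, x.2 + y.2 + beta x.1 y.1).
Definition ext_one : X := (0, 0).
Definition ext_inv (x : X) : X := (- x.1, - x.2 + beta x.1 x.1).

Lemma ext_mulA : associative ext_mul.
Proof.
move=> [a c] [b d] [e f]; congr (_, _); rewrite /= ?addrA //.
rewrite formDl formDr -!addrA; congr (_ + (_ + _)).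
by rewrite [RHS]addrCA; congr (_ + _); rewrite addrCA [beta b e + _]addrC.
Qed.

Lemma ext_mul1 : left_id ext_one ext_mul.
Proof. by move=> [a c]; rewrite /ext_mul /= form0l !(add0r, addr0). Qed.

Lemma ext_mulV : left_inverse ext_one ext_inv ext_mul.
Proof.
by move=> [a c]; congr (_, _); rewrite /= ?addNr // addrAC formNl addrK addNr.
Qed.

HB.instance Definition _ := Finite_isGroup.Build X ext_mulA ext_mul1 ext_mulV.

Local Open Scope group_scope.

Lemma ext_mulE (x y : X) :
  x * y = (x.1 + y.1, x.2 + y.2 + beta x.1 y.1)%R :> X.
Proof. by []. Qed.

Lemma ext_commgE (x y : X) :
  [~ x, y] = (0, beta x.1 y.1 - beta y.1 x.1)%R :> X.
Proof.
apply: (mulgI (y * x)); rewrite -commgC !ext_mulE /= form0r !addr0.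
congr (_, _); first exact: addrC.
by rewrite (addrC y.2) -!addrA [(beta y.1 _ + _)%R]addrC subrK.
Qed.

(** Moving the k-th copy of x past the first k - 1 ones costs k - 1 more
copies of beta x.1 x.1, whence the binomial coefficient. *)
Lemma ext_expgE (x : X) k :
  x ^+ k = (x.1 *+ k, x.2 *+ k + beta x.1 x.1 *+ 'C(k, 2))%R :> X.
Proof.
elim: k => [|k IHk]; first by rewrite expg0 /= addr0.
rewrite expgSr IHk ext_mulE /= formMnl !mulrSr binS bin1 mulrnDr.
by rewrite -!addrA; congr (_, (_ + _))%R; rewrite addrCA.
Qed.

Definition ext_incl (c : C) : X := (0, c)%R.

Lemma ext_incl_inj : injective ext_incl.
Proof. by move=> c d []. Qed.

Lemma ext_inclD c d : ext_incl (c + d)%R = ext_incl c * ext_incl d.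
Proof. by rewrite ext_mulE /= form0l !addr0. Qed.

Lemma center_ext :
    (forall a, (forall b, beta a b = beta b a) -> a = 0%R) ->
  'Z([set: X]) = [set ext_incl c | c : C].
Proof.
move=> beta_nondeg; apply/setP=> x; rewrite inE in_setT /=.
apply/centP/imsetP => [cx | [c _ ->] y _].
  case: x cx => a c cx; exists c => //; congr (_, _); apply: beta_nondeg => b.
  have /commgP/eqP := cx ((b, 0)%R : X) (in_setT _).
  by rewrite ext_commgE /= => -[/eqP]; rewrite subr_eq0 => /eqP.
by apply/commgP/eqP; rewrite ext_commgE /= form0l form0r subrr.
Qed.

(** The hypothesis asks for sums of values and not for single values: this gap
is what leaves room for elements that are not commutators. *)
Lemma der1_ext :
    (forall c, exists s : seq (A * A),
       c = \sum_(ab <- s) (beta ab.1 ab.2 - beta ab.2 ab.1))%R ->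
  [set: X]^`(1) = [set ext_incl c | c : C].
Proof.
move=> beta_gen; apply/eqP; rewrite eqEsubset; apply/andP; split.
  have gC : group_set [set ext_incl c | c : C].
    apply/group_setP; split; first by apply/imsetP; exists 0%R.
    move=> _ _ /imsetP[c _ ->] /imsetP[d _ ->].
    by rewrite -ext_inclD imset_f.
  rewrite (gen_subG _ (Group gC)); apply/subsetP=> _ /imset2P[x y _ _ ->].
  by rewrite ext_commgE; apply/imsetP; exists (beta x.1 y.1 - beta y.1 x.1)%R.
apply/subsetP=> _ /imsetP[c _ ->]; have [s ->] := beta_gen c.
elim: s => [|[a b] s IHs]; first by rewrite big_nil group1.
rewrite big_cons ext_inclD groupM //=.
have := ext_commgE (a, 0%R) (b, 0%R); rewrite -[(0%R, _)]/(ext_incl _) /= => <-.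
exact/mem_commg.
Qed.

Lemma commutators_ext c :
    (forall a b, beta a b - beta b a <> c)%R ->
  ext_incl c \notin commutators [set: X].
Proof.
move=> not_c; rewrite (commutatorsE [set: X]%G).
by apply/imset2P=> -[x y _ _]; rewrite ext_commgE => -[/esym/not_c].
Qed.

End CentralExtension.

(** * The alternating map of a graph *)

(** The three-term Pluecker relation for the 2 x 2 minors of a 2 x 4 matrix. *)
Lemma pluecker (F : comNzRingType) (x0 x1 x2 x3 y0 y1 y2 y3 : F) : (
    (x0 * y1 - y0 * x1) * (x2 * y3 - y2 * x3)
  - (x0 * y2 - y0 * x2) * (x1 * y3 - y1 * x3)
  + (x0 * y3 - y0 * x3) * (x1 * y2 - y1 * x2) = 0)%R.
Proof. by ring. Qed.

Section GraphForm.

Local Open Scope ring_scope.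

Variables (R F : finComNzRingType) (phi : {rmorphism R -> F}) (J : finType).

Let A : finZmodType := (R * R * {ffun J -> F})%type.

(** The vertices are inl false and inl true, whose coordinates live in R, and
the inr j, whose coordinates live in F; vcoord compares them all in F. *)
Definition vcoord (a : A) (v : bool + J) : F :=
  match v with
  | inl b => phi (if b then a.1.2 else a.1.1)
  | inr j => a.2 j
  end.

Lemma vcoordD a b v : vcoord (a + b) v = vcoord a v + vcoord b v.
Proof. by case: v => [[]|j]; rewrite /= ?rmorphD ?ffunE. Qed.

(** The edges other than the one joining inl false to inl true, each oriented
so that its second end is in J. *)
Variable E : {set (bool + J) * J}.

Let C : finZmodType := (R * {ffun {e | e \in E} -> F})%type.

Definition graph_form_fun (a b : A) : C :=
  (a.1.1 * b.1.2, [ffun e => vcoord a (sval e).1 * b.2 (sval e).2]).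

Lemma graph_form_funDl a a' b :
  graph_form_fun (a + a') b = graph_form_fun a b + graph_form_fun a' b.
Proof.
congr (_, _); first exact: mulrDl.
by apply/ffunP=> e; rewrite !ffunE vcoordD mulrDl.
Qed.

Lemma graph_form_funDr a b b' :
  graph_form_fun a (b + b') = graph_form_fun a b + graph_form_fun a b'.
Proof.
congr (_, _); first exact: mulrDr.
by apply/ffunP=> e; rewrite !ffunE mulrDr.
Qed.

Definition graph_form : biadditive A C :=
  Biadditive graph_form_funDl graph_form_funDr.

Hypothesis star : forall j, (inl false, j) \in E.

(** Pairing with the two vertices over R kills the R-coordinates of a, thanks to
the edge between them; pairing with inl false kills its J-coordinates, thanks
to the star. *)
Lemma graph_form_nondeg a :
  (forall b, graph_form a b = graph_form b a) -> a = 0.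
Proof.
case: a => [[x y] z] sym_a.
have [x0 _] := sym_a (0, 1, 0); rewrite mulr1 mul0r in x0.
have [y0 /ffunP z0] := sym_a (1, 0, 0); rewrite mulr0 mul1r in y0.
congr (_, _, _) => //; apply/ffunP=> j.
have := z0 (exist (fun e => e \in E) _ (star j)).
by rewrite !ffunE /= rmorph1 mul1r mulr0.
Qed.

(** No edge inside J occurs with both orientations: otherwise the two
components of an alternating value would be opposite. *)
Hypothesis oriented :
  forall i j, (inr i, j) \in E -> (inr j, i) \notin E.

Definition vbasis_elt (v : bool + J) : A :=
  match v with
  | inl b => (if b then (0, 1) else (1, 0), 0)
  | inr i => (0, 0, [ffun j => (j == i)%:R])
  end.

Lemma vcoord_basis v u : vcoord (vbasis_elt v) u = (u == v)%:R.
Proof. by case: v u => [[]|i] [[]|j]; rewrite /= ?rmorph0 ?rmorph1 ?ffunE. Qed.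

(** An element supported on a single edge uj is the alternating value at
(e_u, y e_j), and the factor R is covered by the values at (x e_0, e_1). *)
Lemma graph_form_gen c : exists s : seq (A * A),
  c = \sum_(ab <- s) (graph_form ab.1 ab.2 - graph_form ab.2 ab.1).
Proof.
case: c => x w.
pose b (e : {e | e \in E}) : A := (0, 0, [ffun j => w e * (j == (sval e).2)%:R]).
exists (((x, 0, 0), (0, 1, 0)) ::
  [seq (vbasis_elt (sval e).1, b e) | e <- enum {: {e | e \in E}}]).
rewrite big_cons big_map big_enum /=.
have -> : graph_form (x, 0, 0) (0, 1, 0) - graph_form (0, 1, 0) (x, 0, 0)
           = (x, 0).
  congr (_, _); first by rewrite /= mulr1 mul0r subr0.
  by apply/ffunP=> e; rewrite !ffunE /= !mulr0 subr0.
have edge e : graph_form (vbasis_elt (sval e).1) (b e)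
              - graph_form (b e) (vbasis_elt (sval e).1)
            = (0, [ffun e' => w e * (e' == e)%:R]).
  congr (_, _); first by rewrite /= mulr0 mul0r subr0.
  apply/ffunP=> e'; rewrite !ffunE vcoord_basis /=.
  (* Only an edge with both orientations could contribute to this term. *)
  have -> : vcoord (b e) (sval e').1 * (vbasis_elt (sval e).1).2 (sval e').2 = 0.
    case: e e' => [[u j] Ee] [[u' j'] Ee'] /=.
    case: u' Ee' => [[]|i'] Ee' /=; rewrite ?rmorph0 ?mul0r //.
    case: u Ee => [[]|i] Ee /=; rewrite !ffunE ?mulr0 //.
    have [ij|] := eqVneq i' _; last by rewrite mulr0 mul0r.
    have [ji|] := eqVneq j' _; last by rewrite mulr0.
    by case/negP: (oriented Ee); rewrite -[X in inr X]ij -[X in (_, X)]ji.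
  rewrite subr0 -val_eqE /= -pair_eqE /= mulrCA -natrM mulnb; congr (_ * _%:R).
rewrite (eq_bigr _ (fun e _ => edge e)).
rewrite -(big_morph (pair 0) (id2 := 0) (op2 := +%R)) //; last first.
  by move=> f g; congr (_, _); rewrite /= addr0.
congr (_, _); first by rewrite /= addr0.
apply/ffunP=> e; rewrite /= add0r sum_ffunE (bigD1 e) //= ffunE eqxx mulr1.
by rewrite big1 ?addr0 // => e' ne; rewrite ffunE eq_sym (negPf ne) mulr0.
Qed.

Hypotheses (j0 j1 : J) (j01 : j0 != j1) (Ej0 : (inl true, j0) \in E).

(** Number the vertices inl false, inl true, inr j0, inr j1 as 0, 1, 2, 3. The
value c below would have p01 = p02 = 0 and p03 = p12 = 1, against the
three-term relation. *)
Lemma graph_form_not_value : exists c, forall a b,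
  graph_form a b - graph_form b a <> c.
Proof.
pose e1 : {e | e \in E} := exist (fun e => e \in E) _ (star j1).
pose e2 : {e | e \in E} := exist (fun e => e \in E) _ Ej0.
exists (0, [ffun e => ((e == e1) || (e == e2))%:R]).
move=> [[a0 a1] a] [[b0 b1] b] [p01 /ffunP p].
have := p e2; have := p e1; have := p (exist (fun e => e \in E) _ (star j0)).
rewrite !ffunE /= -!val_eqE /= !xpair_eqE !eqxx /= (negPf j01).
move=> p02 p03 p12.
have p01' : phi a0 * phi b1 - phi b0 * phi a1 = 0.
  by rewrite -!rmorphM -rmorphB p01 rmorph0.
have := pluecker (phi a0) (phi a1) (a j0) (a j1) (phi b0) (phi b1) (b j0) (b j1).
by rewrite p01' p02 p03 p12 !mul0r !mul1r subrr add0r => /eqP; rewrite oner_eq0.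
Qed.

Lemma graph_form_mulrn0 N : N%:R = 0 :> R ->
  (forall a : A, a *+ N = 0) /\ (forall c : C, c *+ N = 0).
Proof.
move=> N0; have N0F : N%:R = 0 :> F by rewrite -(rmorph_nat phi) N0 rmorph0.
have mulrn0 (S : pzRingType) (x : S) : N%:R = 0 :> S -> x *+ N = 0.
  by move=> NS0; rewrite -mulr_natr NS0 mulr0.
have pairMn (U V : zmodType) (u : U) (v : V) : (u, v) *+ N = (u *+ N, v *+ N).
  by elim: N {N0 N0F mulrn0} => // N IHN; rewrite !mulrS IHN.
split=> [[[x y] z] | [x w]]; rewrite !pairMn; congr (_, _).
- by congr (_, _); apply: mulrn0.
- by apply/ffunP=> j; rewrite ffunMnE ffunE mulrn0.
- exact: mulrn0.
- by apply/ffunP=> j; rewrite ffunMnE ffunE mulrn0.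
Qed.

End GraphForm.

(** * Choosing the edges *)

Lemma subset_of_card (T : finType) (A B : {set T}) n :
  A \subset B -> #|A| <= n <= #|B| ->
  exists D : {set T}, [/\ A \subset D, D \subset B & #|D| = n].
Proof.
move=> sAB /andP[leAn lenB].
have : 0 < #|[set D : {set T} | D \subset B :\: A & #|D| == n - #|A|]|.
  by rewrite cards_draws bin_gt0 cardsDS // leq_sub2r.
case/card_gt0P=> D; rewrite inE subsetD => /andP[/andP[sDB disDA] /eqP cD].
exists (A :|: D); split; first exact: subsetUl.
  by rewrite subUset sAB.
rewrite cardsU cD setIC; move: disDA; rewrite -setI_eq0 => /eqP->.
by rewrite cards0 subn0 subnKC.
Qed.

(** Orienting edges towards the larger index makes each edge of the complete
graph on k + 2 vertices appear exactly once, apart from the edge that joins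
inl false to inl true, which is missing. *)
Definition prec k (v : bool + 'I_k) (j : 'I_k) : bool :=
  if v is inr i then i < j else true.

Lemma card_prec k : #|[set e | @prec k e.1 e.2]| = 2 * k + 'C(k, 2).
Proof.
rewrite -sum1dep_card -(pair_big_dep xpredT (@prec k) (fun _ _ => 1)) /=.
rewrite big_sumType big_bool /= !sum1_card card_ord addnn mul2n; congr (_ + _).
rewrite (exchange_big_dep xpredT) //= -bin2_sum big_mkord.
apply: eq_bigr => j _.
by rewrite (big_ord_narrow (ltnW (ltn_ord j))) sum1_card card_ord.
Qed.

(** A star and one more edge, closing a triangle with the edge from inl false to
inl true, take k + 1 edges; further ones are added until there are M. *)
Lemma exists_edges k M (k_gt0 : 0 < k) : k < M -> M <= 2 * k + 'C(k, 2) ->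
  exists E : {set (bool + 'I_k) * 'I_k},
    [/\ forall j, (inl false, j) \in E, (inl true, Ordinal k_gt0) \in E,
        forall i j, (inr i, j) \in E -> (inr j, i) \notin E & #|E| = M].
Proof.
move=> lt_kM leM; set j0 := Ordinal k_gt0.
pose E0 : {set (bool + 'I_k) * 'I_k} :=
  (inl true, j0) |: setX [set inl false] setT.
have cE0 : #|E0| = k.+1.
  by rewrite cardsU1 cardsX !inE /= cards1 cardsT card_ord mul1n.
have [E [sE0 sE cE]] : exists E : {set (bool + 'I_k) * 'I_k},
    [/\ E0 \subset E, E \subset [set e | prec e.1 e.2] & #|E| = M].
  apply: subset_of_card; last by rewrite cE0 card_prec lt_kM.
  apply/subsetP=> -[u j].
  by case/setU1P => [[-> _] | /setXP[/set1P-> _]]; rewrite inE.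
exists E; split=> // [j||i j].
- by rewrite (subsetP sE0) // !inE orbT.
- by rewrite (subsetP sE0) // setU11.
- move=> /(subsetP sE); rewrite inE /= => lt_ij.
  by apply/negP=> /(subsetP sE); rewrite inE /= ltnNge ltnW.
Qed.

(** * Residues modulo p^r and the exponent *)

Lemma Zp_reduction q d :
  0 < q -> 1 < d -> d %| q -> {rmorphism 'Z_q -> 'Z_d}.
Proof.
move=> q_gt0 d_gt1 d_dvd_q.
have q_gt1 : 1 < q := leq_trans d_gt1 (dvdn_leq q_gt0 d_dvd_q).
pose red (x : 'Z_q) : 'Z_d := (x : nat)%:R%R.
have red_nat n : red n%:R%R = n%:R%R.
  by rewrite /red val_Zp_nat // -[LHS]Zp_nat_mod // modn_dvdm // Zp_nat_mod.
have redD : nmod_morphism red.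
  split=> [|x y]; first exact: (red_nat 0).
  by rewrite -[x in LHS]natr_Zp -[y in LHS]natr_Zp -natrD red_nat natrD.
have redM : monoid_morphism red.
  split=> [|x y]; first exact: (red_nat 1).
  by rewrite -[x in LHS]natr_Zp -[y in LHS]natr_Zp -natrM red_nat natrM.
pose redZ := GRing.isNmodMorphism.Build _ _ red redD.
pose redR := GRing.isMonoidMorphism.Build _ _ red redM.
exact: (HB.pack red redZ redR : {rmorphism 'Z_q -> 'Z_d}).
Qed.

Section Exponent.

Variables (p r : nat) (p_pr : prime p) (r_gt0 : 0 < r).
Variables (F : finComNzRingType) (phi : {rmorphism 'Z_(p ^ r) -> F}).
Variables (J : finType) (E : {set (bool + J) * J}).
Let X := central_ext (graph_form phi E).

(** The upper bounds come from the formula for powers. The lower bound p^r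
already holds in the centre; for p = 2 the element e_0 + e_1 exceeds it, as its
beta-square generates the factor R. *)
Lemma exponent_graph_ext :
  exponent [set: X] = if p == 2 then 2 ^ r.+1 else p ^ r.
Proof.
have p_gt1 := prime_gt1 p_pr.
have q_gt1 : 1 < p ^ r by rewrite -(exp1n r) ltn_exp2r.
have Zq0 N : p ^ r %| N -> N%:R%R = 0%R :> 'Z_(p ^ r).
  by move=> /dvdnP[k ->]; rewrite natrM pchar_Zp // mulr0.
have Zq_dvd N : N%:R%R = 0%R :> 'Z_(p ^ r) -> p ^ r %| N.
  by move/(congr1 val) => /=; rewrite val_Zp_nat // => /eqP.
have exp_dvd N : p ^ r %| N -> p ^ r %| 'C(N, 2) -> exponent [set: X] %| N.
  move=> qN qN2; apply/exponentP=> x _; rewrite ext_expgE.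
  have [A0 C0] := graph_form_mulrn0 phi E (Zq0 _ qN).
  have [_ C0'] := graph_form_mulrn0 phi E (Zq0 _ qN2).
  by rewrite A0 C0 C0' addr0.
have dvd_exp : p ^ r %| exponent [set: X].
  have /exponentP/(_ ((0, (1, 0))%R : X) (in_setT _)) := dvdnn (exponent [set: X]).
  rewrite ext_expgE => /(congr1 (fun x : X => x.2.1)) /=.
  by rewrite !(raddfMn fst) /= mul0r mul0rn addr0 => /Zq_dvd.
case: eqP => [p2 | /eqP p'2]; last first.
  apply/eqP; rewrite eqn_dvd dvd_exp andbT exp_dvd // bin2odd ?dvdn_mulr //.
  by rewrite oddX; case/even_prime: p_pr p'2 => [-> // | ->]; rewrite orbT.
(* For e_0 + e_1 the binomial coefficient of 2 q' over 2 with q' = 2 ^ (r - 1)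
   is q' times the odd number 2 q' - 1, hence nonzero modulo 2 q'. *)
have def_q : p ^ r = 2 * 2 ^ r.-1 by rewrite -expnS prednK ?p2.
have : exponent [set: X] %| 2 ^ r.+1.
  apply: exp_dvd; first by rewrite p2 dvdn_exp2l.
  by rewrite bin2 expnS -mulnA mul2n doubleK p2 dvdn_mulr.
case/(dvdn_pfactor _ _ (isT : prime 2)) => m le_mr def_e.
rewrite def_e; congr (2 ^ _); apply/eqP; rewrite eqn_leq le_mr ltnNge.
apply/negP=> le_m_r.
have /exponentP/(_ (((1, 1), 0), 0)%R (in_setT _)) : exponent [set: X] %| p ^ r.
  by rewrite def_e p2 dvdn_exp2l.
rewrite ext_expgE => /(congr1 (fun x : X => x.2.1)) /=.
rewrite !(raddfMn fst) /= mul0rn add0r mulr1 => /Zq_dvd.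
rewrite bin2 def_q -[X in X./2]mulnA [X in X./2]mul2n doubleK mulnC.
rewrite dvdn_pmul2l ?expn_gt0 // dvdn2 muln2.
case: (2 ^ r.-1) (expn_gt0 2 r.-1) => // h _.
by rewrite doubleS /= odd_double.
Qed.

End Exponent.

(** * The theorem *)

Theorem corollary4p9 (p r s t : nat) :
  prime p -> (0 < r)%N -> (0 < s)%N -> (0 < t)%N ->
  let m : int := (s%:Z - r%:Z + 1)%R in
  let n : int := (t%:Z - s%:Z - 2 * r%:Z + 2)%R in
  (4 <= n)%R -> (n <= m)%R -> (2 * m <= n * (n - 1))%R ->
  exists (gT : finGroupType) (G : {group gT}),
    [/\ (p.-group G)%g /\ nil_class G = 2%N,
        [/\ #|G| = (p ^ t)%N, #|'Z(G)%g| = (p ^ s)%N & #|(G^`(1))%g| = (p ^ s)%N],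
        exponent G = (if p == 2%N then 2 ^ r.+1 else p ^ r)%N
      & commutators G <> (G^`(1))%g].
Proof.
move=> p_pr r_gt0 s_gt0 t_gt0 m n n_ge4 le_nm le_mn.
(* k counts the vertices whose factor has order p, and M the edges whose factor
   has order p. *)
have [k def_k] : exists k, t = s + 2 * r + k.
  by exists (t - s - 2 * r); rewrite {}/m {}/n in n_ge4 le_nm le_mn *; lia.
have [M def_s] : exists M, s = r + M.
  by exists (s - r); rewrite {}/m {}/n in n_ge4 le_nm le_mn *; lia.
have [def_n def_m] : n = (k%:Z + 2)%R /\ m = (M%:Z + 1)%R by rewrite /n /m; lia.
rewrite {}def_n {}def_m {m n} in n_ge4 le_nm le_mn.
have [k_gt1 lt_kM leM] : [/\ 1 < k, k < M & M <= 2 * k + 'C(k, 2)].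
  have C2 : 'C(k, 2) * 2 = k * k.-1.
    by have := bin_ffact k 2; rewrite !ffactnS ffactn0 muln1.
  by split; nia.
have p_gt1 := prime_gt1 p_pr; have p_gt0 := prime_gt0 p_pr.
have q_gt0 : 0 < p ^ r by rewrite expn_gt0 p_gt0.
pose phi := Zp_reduction q_gt0 p_gt1 (dvdn_exp r_gt0 (dvdnn p)).
have [E [star Ej0 oriented cE]] := exists_edges (ltnW k_gt1) lt_kM leM.
pose X := central_ext (graph_form phi E).
have ZX := center_ext (@graph_form_nondeg _ _ phi _ _ star).
have dX := der1_ext (@graph_form_gen _ _ phi _ _ oriented).
have cF : #|'Z_p| = p by rewrite card_ord Zp_cast.
have cR : #|'Z_(p ^ r)| = p ^ r.
  by rewrite card_ord Zp_cast // -(exp1n r) ltn_exp2r.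
have der_center : [set: X]^`(1)%g = 'Z([set: X])%g by rewrite dX ZX.
have cZ : #|'Z([set: X])%g| = p ^ s.
  rewrite ZX card_imset; last exact: ext_incl_inj.
  by rewrite card_prod card_ffun card_sig cF cR cE -expnD def_s.
have cX : #|[set: X]| = p ^ t.
  rewrite cardsT !card_prod !card_ffun card_sig cF cR cE card_ord.
  rewrite -?expnM -!expnD def_k def_s.
  by congr (p ^ _); lia.
exists X, [set: X]%G; split.
- split; first by rewrite /pgroup cX pnatX pnat_id.
  apply/eqP; rewrite eqn_leq nil_class2 der_center subxx ltnNge nil_class1.
  apply/derG1P => d1; move: cZ; rewrite -der_center d1 cards1 => /eqP.
  by rewrite ltn_eqF // -(exp1n s) ltn_exp2r.
- by rewrite cX der_center cZ.
- exact: exponent_graph_ext.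
have j01 : Ordinal (ltnW k_gt1) != Ordinal k_gt1 by [].
have [c not_c] := graph_form_not_value phi star j01 Ej0.
have cK : ext_incl (graph_form phi E) c \notin _ := commutators_ext not_c.
by move=> eqK; case/negP: cK; rewrite eqK dX; apply: imset_f.
Qed.
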